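(* Let $\Phi : M_2(\mathbb{C}) \to M_2(\mathbb{C})$ be a unital quantum channel, and let $\lambda_1, \lambda_2, \lambda_3 \in \mathbb{R}$ be the diagonal entries of the Pauli-diagonal form of $\Phi$ (as described in the context). Then the fixed point set $M_2^\Phi = \{X \in M_2(\mathbb{C}) : \Phi(X) = X\}$ is a $*$-subalgebra of $M_2(\mathbb{C})$ containing the identity operator and satisfying one of the following conditions. (i) $M_2^\Phi = M_2(\mathbb{C})$ if and only if each $\lambda_k = 1$ and $\Phi$ is the identity map. (ii) $M_2^\Phi = \mathbb{C} I$ if and only if $\lambda_k \neq 1$ for $k = 1,2,3$. (iii) $M_2^\Phi = \operatorname{span}\{ |v_1\rangle\langle v_1|, |v_2\rangle\langle v_2| \}$, where $\{v_1, v_2\}$ is an orthonormal basis for $\mathbb{C}^2$ and $|v_i\rangle\langle v_i|$ is the rank one projection of $\mathbb{C}^2$ onto $\operatorname{span}\{v_i\}$, and this case holds if and only if exactly one of $\lambda_1, \lambda_2, \lambda_3$ is equal to $1$.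
   Context: A quantum channel on $M_2(\mathbb{C}) = \mathcal{B}(\mathbb{C}^2)$ is a completely positive trace preserving linear map; it is unital if $\Phi(I) = I$. The Pauli matrices are $\sigma_x = \begin{pmatrix} 0 & 1 \\ 1 & 0 \end{pmatrix}$, $\sigma_y = \begin{pmatrix} 0 & -i \\ i & 0 \end{pmatrix}$, $\sigma_z = \begin{pmatrix} 1 & 0 \\ 0 & -1 \end{pmatrix}$; together with $I$ they form a basis of $M_2(\mathbb{C})$. Every unital quantum channel on $M_2(\mathbb{C})$ is equivalent, through unitary conjugations at both the input and output stages, to a map that is diagonal and real with respect to this basis, that is, a map (again denoted $\Phi$) with $\Phi(I) = I$, $\Phi(\sigma_x) = \lambda_1 \sigma_x$, $\Phi(\sigma_y) = \lambda_2 \sigma_y$, $\Phi(\sigma_z) = \lambda_3 \sigma_z$, where $\lambda_1, \lambda_2, \lambda_3 \in \mathbb{R}$. These are the numbers $\lambda_k$ in the claim.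
   Formalization: The equivalences in (i)–(iii) are stated for the Pauli-diagonal form of Φ, not for Φ before diagonalization, where they fail: conjugation by σ_x has the identity as a diagonal form (all λ_k = 1) but fixed points span{I, σ_x}. *)

(* Defs.v *)
From HB Require Import structures.
From mathcomp Require Import all_boot all_order all_algebra.
From mathcomp Require Import reals complex.

Set Implicit Arguments.
Unset Strict Implicit.
Unset Printing Implicit Defensive.

Import Order.TTheory GRing.Theory Num.Theory.
Local Open Scope ring_scope.
Local Open Scope sesquilinear_scope.

Section Channels.
Variable C : numClosedFieldType.

(* In a numClosedFieldType, 0 <= z entails that z is real. *)
Definition psdmx n (A : 'M[C]_n) : Prop :=
  forall v : 'cV[C]_n, 0 <= (v^t* *m A *m v) 0 0.

(* The map id_k (x) Phi on M_k(M_n(C)), whose elements are k x k block matrices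
   with n x n blocks. *)
Definition ampliation n k (Phi : 'M[C]_n -> 'M[C]_n)
    (X : 'M[C]_(\sum_(i < k) n)) : 'M[C]_(\sum_(i < k) n) :=
  \mxblock_(i < k, j < k) Phi (submxblock X i j).

Definition completely_positive n (Phi : 'M[C]_n -> 'M[C]_n) : Prop :=
  forall k (X : 'M[C]_(\sum_(i < k) n)), psdmx X -> psdmx (ampliation Phi X).

Definition trace_preserving n (Phi : 'M[C]_n -> 'M[C]_n) : Prop :=
  forall X, \tr (Phi X) = \tr X.

Definition quantum_channel n (Phi : {linear 'M[C]_n -> 'M[C]_n}) : Prop :=
  completely_positive Phi /\ trace_preserving Phi.

Definition unital n (Phi : 'M[C]_n -> 'M[C]_n) : Prop := Phi 1%:M = 1%:M.

Definition fixed_points (Phi : {linear 'M[C]_2 -> 'M[C]_2}) : {vspace 'M[C]_2} :=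
  fixedSpace (linfun Phi).

(* subalg_closed includes membership of the identity. *)
Definition unital_star_subalgebra (A : {vspace 'M[C]_2}) : Prop :=
  subalg_closed (mem A) /\ (forall X, X \in A -> X^t* \in A).

(* Two orthonormal vectors form a basis of C^2 by dimension. *)
Definition orthonormal_basis2 (v1 v2 : 'cV[C]_2) : Prop :=
  [/\ v1^t* *m v1 = 1%:M, v2^t* *m v2 = 1%:M & v1^t* *m v2 = 0].

Definition span_of_orthonormal_projections (A : {vspace 'M[C]_2}) : Prop :=
  exists v1 v2 : 'cV[C]_2, orthonormal_basis2 v1 v2 /\
    A = <<[:: v1 *m v1^t*; v2 *m v2^t*]>>%VS.

Definition mx2 (a b c d : C) : 'M[C]_2 :=
  \matrix_(i, j) if i == 0 then (if j == 0 then a else b)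
                 else (if j == 0 then c else d).

Definition sigma_x : 'M[C]_2 := mx2 0 1 1 0.
Definition sigma_y : 'M[C]_2 := mx2 0 (- 'i) 'i 0.
Definition sigma_z : 'M[C]_2 := mx2 1 0 0 (-1).

End Channels.

Definition pauli_diagonal (R : realType) (Psi : 'M[R[i]]_2 -> 'M[R[i]]_2)
    (l1 l2 l3 : R) : Prop :=
  [/\ Psi 1%:M = 1%:M,
      Psi (sigma_x _) = l1%:C%C *: sigma_x _,
      Psi (sigma_y _) = l2%:C%C *: sigma_y _
    & Psi (sigma_z _) = l3%:C%C *: sigma_z _].

(* Psi, with entries l1, l2, l3, is a Pauli-diagonal form of Phi: it is obtained
   from Phi by unitary conjugations at the input and at the output. *)
Definition pauli_diagonal_form (R : realType)
    (Phi Psi : 'M[R[i]]_2 -> 'M[R[i]]_2) (l1 l2 l3 : R) : Prop :=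
  (exists U V : 'M[R[i]]_2, [/\ U \is unitarymx, V \is unitarymx &
     forall X, Psi X = V *m Phi (U *m X *m U^t*) *m V^t*]) /\
  pauli_diagonal Psi l1 l2 l3.

(* Main.v *)
(* For a fixed point X of a unital channel Phi, the Kadison-Schwarz inequality
   makes Phi(X* X) - X* X positive; its trace is 0, so X* X is fixed, and by
   polarization so is X* Y for fixed X and Y.  A *-subalgebra of M_2 with a
   non-scalar element contains a non-scalar Hermitian H, hence the two spectral
   projections of H, and it is all of M_2 as soon as it contains a matrix with
   a nonzero off-diagonal entry in the eigenbasis of H.  For a Pauli-diagonal
   map, the fixed points are spanned by the fixed Pauli matrices, so the three
   cases are told apart by dimension. *)

Require Import Defs.
From HB Require Import structures.
From mathcomp Require Import all_boot all_order all_algebra.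
From mathcomp Require Import reals complex.

Set Implicit Arguments.
Unset Strict Implicit.
Unset Printing Implicit Defensive.

Import Order.TTheory GRing.Theory Num.Theory.
Local Open Scope ring_scope.
(** Expanding a fixed [x] in the eigenbasis, freeness turns [f x - x = 0] into
    [(c i - 1) * coord b i x = 0], so only eigenvectors of eigenvalue 1 contribute to [x]. *)
Lemma fixedSpace_eigenbasis (K : fieldType) (vT : vectType K) (f : 'End(vT))
    n (b : n.-tuple vT) :
  basis_of {:vT} b -> {in b, forall v, exists c, f v = c *: v} ->
  fixedSpace f = <<[seq v <- b | f v == v]>>%VS.
Proof.
move=> basis_b eigen; apply/vspaceP => x.
apply/fixedSpaceP/idP => [fx|xs]; last first.
  apply/fixedSpaceP; apply: subvP xs.
  apply/span_subvP => v; rewrite mem_filter => /andP[/eqP fv _].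
  exact/fixedSpaceP.
have /fin_all_exists[c eigen_b] : forall i : 'I_n, exists c, f b`_i = c *: b`_i.
  by move=> i; apply: eigen; rewrite mem_nth ?size_tuple.
have xE := coord_basis basis_b (memvf x).
have coord0 i : (c i - 1) * coord b i x = 0.
  have /freeP/(_ (fun i => (c i - 1) * coord b i x)) := basis_free basis_b.
  apply.
  rewrite -[RHS](subrr x) -[X in _ = X - _]fx [in RHS]xE linear_sum -sumrB.
  apply: eq_bigr => j _; rewrite linearZ /= eigen_b.
  by rewrite mulrBl mul1r scalerBl scalerA mulrC.
rewrite xE memv_suml // => i _.
have /eqP := coord0 i; rewrite mulf_eq0 subr_eq0 => /orP[ci|/eqP->].
  2: by rewrite scale0r mem0v.
rewrite memvZ // memv_span // mem_filter eigen_b (eqP ci) scale1r eqxx /=.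
by rewrite mem_nth // size_tuple.
Qed.

Section UnitalQubitChannels.
Local Open Scope sesquilinear_scope.
Variable C : numClosedFieldType.

(** * Conjugate transposes, including those of block matrices *)

Lemma trmxC_mul m n p (A : 'M[C]_(m, n)) (B : 'M[C]_(n, p)) :
  (A *m B)^t* = B^t* *m A^t*.
Proof. by rewrite trmx_mul map_mxM. Qed.

Lemma trmxCD m n (A B : 'M[C]_(m, n)) : (A + B)^t* = A^t* + B^t*.
Proof. by rewrite linearD map_mxD. Qed.

Lemma trmxCN m n (A : 'M[C]_(m, n)) : (- A)^t* = - A^t*.
Proof. by rewrite linearN map_mxN. Qed.

Lemma trmxCZ m n (a : C) (A : 'M[C]_(m, n)) : (a *: A)^t* = a^* *: A^t*.
Proof. by rewrite linearZ map_mxZ. Qed.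

Lemma trmxC1 n : (1%:M : 'M[C]_n)^t* = 1%:M.
Proof. by rewrite trmx1 map_mx1. Qed.

Lemma trmxC_mxrow m k (p_ : 'I_k -> nat) (B_ : forall j, 'M[C]_(m, p_ j)) :
  (\mxrow_j B_ j)^t* = \mxcol_j (B_ j)^t*.
Proof. by rewrite tr_mxrow; apply/matrixP => i j; rewrite !mxE. Qed.

Lemma trmxC_mxcol m k (p_ : 'I_k -> nat) (B_ : forall i, 'M[C]_(p_ i, m)) :
  (\mxcol_i B_ i)^t* = \mxrow_i (B_ i)^t*.
Proof. by rewrite tr_mxcol; apply/matrixP => i j; rewrite !mxE. Qed.

Lemma trmxC_mxblock k (p_ : 'I_k -> nat) (B_ : forall i j, 'M[C]_(p_ i, p_ j)) :
  (\mxblock_(i, j) B_ i j)^t* = \mxblock_(i, j) (B_ j i)^t*.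
Proof. by rewrite tr_mxblock; apply/matrixP => i j; rewrite !mxE. Qed.

(** * Positive semidefinite matrices *)

Lemma trmxC_mulmx_ge0 n (u : 'cV[C]_n) : 0 <= (u^t* *m u) 0 0.
Proof.
by rewrite mxE sumr_ge0 // => i _; rewrite !mxE mulrC mul_conjC_ge0.
Qed.

Lemma form_delta n (A : 'M[C]_n) i j :
  ((delta_mx i 0 : 'cV_n)^t* *m A *m (delta_mx j 0 : 'cV_n)) 0 0 = A i j.
Proof. by rewrite trmx_delta map_delta_mx -rowE -colE !mxE. Qed.

Lemma psdmx_diag_ge0 n (A : 'M[C]_n) i : psdmx A -> 0 <= A i i.
Proof. by move=> /(_ (delta_mx i 0)); rewrite form_delta. Qed.

Lemma add_sub_eq0 (V : lmodType C) (x y : V) :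
  x + y = 0 -> x - y = 0 -> x = 0 /\ y = 0.
Proof.
move=> xy /subr0_eq x_y; suff y0 : y = 0 by rewrite x_y y0.
by move/eqP: xy; rewrite x_y -mulr2n -scaler_nat scaler_eq0 pnatr_eq0 => /eqP.
Qed.

(** At the vector [e_i + d e_j] the form reduces to [d * A i j + d^* * A j i]. Its positivity at [d]
    and [- d] makes it vanish, and the values [1] and ['i] of [d] then separate the two entries. *)
Lemma psdmx_diag0 n (A : 'M[C]_n) :
  psdmx A -> (forall i, A i i = 0) -> A = 0.
Proof.
have mxDE (P Q : 'M[C]_1) : (P + Q) 0 0 = P 0 0 + Q 0 0 by rewrite mxE.
have mxZE a (P : 'M[C]_1) : (a *: P) 0 0 = a * P 0 0 by rewrite mxE.
move=> psdA diagA; apply/matrixP => i j; rewrite mxE.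
have q c : c * A i j + c^* * A j i = 0.
  have pos d : 0 <= d * A i j + d^* * A j i.
    have := psdA (delta_mx i 0 + d *: delta_mx j 0).
    rewrite trmxCD trmxCZ !(mulmxDl, mulmxDr) -!(scalemxAl, scalemxAr).
    rewrite 3!mxDE 4!mxZE !form_delta !diagA.
    by rewrite !mulr0 addr0 add0r addrC.
  apply/eqP; rewrite eq_le pos andbT.
  by have := pos (- c); rewrite rmorphN !mulNr -opprD oppr_ge0.
have ij_add : A i j + A j i = 0 by have := q 1; rewrite rmorph1 !mul1r.
have /eqP := q 'i; rewrite conjCi mulNr -mulrBr mulf_eq0 (negPf (neq0Ci C)) /=.
by move=> /eqP ij_sub; have [] := add_sub_eq0 (V := C^o) ij_add ij_sub.
Qed.

Lemma psdmx_trace0 n (A : 'M[C]_n) : psdmx A -> \tr A = 0 -> A = 0.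
Proof.
move=> psdA /psumr_eq0P A0; apply: psdmx_diag0 => // i.
by apply: A0 => // j _; apply: psdmx_diag_ge0.
Qed.

(** Since [A] has real form values, the form of [A^t* - A] vanishes identically; this difference is
    thus positive with zero diagonal. *)
Lemma psdmx_hermitian n (A : 'M[C]_n) : psdmx A -> A^t* = A.
Proof.
move=> psdA.
have form0 (v : 'cV_n) : (v^t* *m (A^t* - A) *m v) 0 0 = 0.
  rewrite mulmxBr mulmxBl.
  have -> : v^t* *m A^t* *m v = (v^t* *m A *m v)^t*.
    by rewrite !trmxC_mul trmxCK mulmxA.
  have := geC0_conj (psdA v); move: (_ *m v) => P P_real.
  by rewrite !mxE P_real subrr.
apply/eqP; rewrite -subr_eq0; apply/eqP/psdmx_diag0 => [v|i].
  by rewrite form0.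
by rewrite -form_delta form0.
Qed.

(** * Completely positive maps and the Kadison-Schwarz inequality *)

Lemma mxblock_gram_psd n k (Y : 'I_k -> 'M[C]_n) :
  psdmx (\mxblock_(i < k, j < k) ((Y i)^t* *m Y j)).
Proof.
(* With [R] the block row of the [Y j], the matrix is [R^t* *m R], and its form at [v] is the
   squared norm of [R *m v]. *)
move=> v; rewrite -mul_mxcol_mxrow -trmxC_mxrow.
by rewrite mulmxA -mulmxA -trmxC_mul trmxC_mulmx_ge0.
Qed.

Lemma completely_positive_gram n k (Phi : 'M[C]_n -> 'M[C]_n)
    (Y : 'I_k -> 'M[C]_n) : completely_positive Phi ->
  psdmx (\mxblock_(i < k, j < k) Phi ((Y i)^t* *m Y j)).
Proof.
move=> cpPhi; have := cpPhi k _ (mxblock_gram_psd Y).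
rewrite /ampliation; congr psdmx; apply: eq_mxblock => i j.
by rewrite mxblockK.
Qed.

(** The image of the Gram block matrix of [(1, X)] is positive, hence Hermitian; compare its two
    off-diagonal blocks. *)
Lemma completely_positive_trmxC n (Phi : 'M[C]_n -> 'M[C]_n) X :
  completely_positive Phi -> Phi (X^t*) = (Phi X)^t*.
Proof.
pose Y (i : 'I_2) := if i == 0 then 1%:M else X.
move=> /(completely_positive_gram (k := 2) Y) /psdmx_hermitian.
rewrite trmxC_mxblock => psdB.
have {psdB} := congr1 (fun A => @submxblock _ _ _ (fun=> n) (fun=> n) A 1 0) psdB.
by rewrite !mxblockK /Y /= trmxC1 mulmx1 mul1mx => ->.
Qed.

(* Positivity of the image of the Gram block matrix of (X, 1), tested at the
   vector (v, - Phi X v). *)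
Lemma kadison_schwarz n (Phi : 'M[C]_n -> 'M[C]_n) X :
  completely_positive Phi -> Phi 1%:M = 1%:M ->
  psdmx (Phi (X^t* *m X) - (Phi X)^t* *m Phi X).
Proof.
move=> cpPhi Phi1 v.
pose Y (i : 'I_2) := if i == 0 then X else 1%:M.
pose w (i : 'I_2) := if i == 0 then v else - (Phi X *m v).
have := completely_positive_gram (k := 2) Y cpPhi (\mxcol_i w i).
rewrite -mulmxA mul_mxblock_mxrow trmxC_mxcol mul_mxrow_mxcol.
rewrite !big_ord_recl !big_ord0 !addr0 /Y /w /=.
rewrite trmxC1 !mulmx1 mul1mx Phi1 (completely_positive_trmxC X cpPhi).
rewrite mul1mx subrr mulmx0 addr0 mulmxN mulmxA.
by rewrite -mulmxBl mulmxA.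
Qed.

(** * Fixed points of a unital channel form a *-subalgebra *)

Section FixedPoints.
Variables (n : nat) (Phi : {linear 'M[C]_n -> 'M[C]_n}).
Hypotheses (channelPhi : quantum_channel Phi) (unitalPhi : unital Phi).

Lemma fixed_trmxC X : Phi X = X -> Phi (X^t*) = X^t*.
Proof.
by case: channelPhi => cpPhi _ PhiX; rewrite completely_positive_trmxC ?PhiX.
Qed.

Lemma fixed_trmxC_mul_self X : Phi X = X -> Phi (X^t* *m X) = X^t* *m X.
Proof.
case: channelPhi => cpPhi tpPhi PhiX; apply/subr0_eq/psdmx_trace0.
  by have := kadison_schwarz X cpPhi unitalPhi; rewrite PhiX.
by rewrite linearB /= tpPhi subrr.
Qed.

Lemma fixed_trmxC_mul X Y : Phi X = X -> Phi Y = Y ->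
  Phi (X^t* *m Y) = X^t* *m Y.
Proof.
move=> PhiX PhiY; pose D Z := Phi Z - Z.
have DD Z T : D (Z + T) = D Z + D T by rewrite /D linearD opprD addrACA.
have DZ a Z : D (a *: Z) = a *: D Z by rewrite /D linearZ scalerBr.
(* The defect [D] vanishes on the square of [X + a *: Y] and on those of [X] and [Y], which leaves
   the cross terms; [a = 1] and [a = 'i] then separate them. *)
have polar a : a *: D (X^t* *m Y) + a^* *: D (Y^t* *m X) = 0.
  have : D ((X + a *: Y)^t* *m (X + a *: Y)) = 0.
    by rewrite /D fixed_trmxC_mul_self ?subrr // linearD linearZ /= PhiX PhiY.
  rewrite trmxCD trmxCZ !(mulmxDl, mulmxDr) -!(scalemxAl, scalemxAr).
  rewrite !DD !DZ.
  have D0 Z : Phi Z = Z -> D (Z^t* *m Z) = 0.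
    by move=> /fixed_trmxC_mul_self; rewrite /D => ->; rewrite subrr.
  by rewrite !D0 // !scaler0 addr0 add0r addrC.
apply: subr0_eq; rewrite -/(D _).
have XY_add : D (X^t* *m Y) + D (Y^t* *m X) = 0.
  by have := polar 1; rewrite rmorph1 !scale1r.
have /eqP := polar 'i; rewrite conjCi scaleNr -scalerBr scaler_eq0.
rewrite (negPf (neq0Ci C)) /=.
by move=> /eqP XY_sub; have [] := add_sub_eq0 XY_add XY_sub.
Qed.

End FixedPoints.

Lemma fixed_pointsP (Phi : {linear 'M[C]_2 -> 'M[C]_2}) X :
  reflect (Phi X = X) (X \in fixed_points Phi).
Proof. by apply: (iffP fixedSpaceP); rewrite lfunE. Qed.

Lemma fixed_points_star_subalgebra (Phi : {linear 'M[C]_2 -> 'M[C]_2}) :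
  quantum_channel Phi -> unital Phi ->
  unital_star_subalgebra (fixed_points Phi).
Proof.
move=> channelPhi unitalPhi; split; last first.
  by move=> X /fixed_pointsP PhiX; apply/fixed_pointsP/fixed_trmxC.
split=> [|a X Y XA YA|X Y /fixed_pointsP PhiX /fixed_pointsP PhiY].
- exact/fixed_pointsP.
- exact: rpredD (rpredZ _ _) _.
- apply/fixed_pointsP; rewrite -[X]trmxCK.
  exact/fixed_trmxC_mul/PhiY/fixed_trmxC.
Qed.

(** * Unital *-subalgebras of the 2 x 2 matrices *)

Lemma orthonormal_basis2_complete (v1 v2 : 'cV[C]_2) :
  orthonormal_basis2 v1 v2 -> v1 *m v1^t* + v2 *m v2^t* = 1%:M.
Proof.
case=> v11 v22 v12; rewrite -mul_row_col.
have v21 : v2^t* *m v1 = 0.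
  by rewrite -(trmxCK v1) -trmxC_mul v12 trmx0 map_mx0.
(* Orthonormality says that the adjoint of the square matrix [row_mx v1 v2] is a left inverse; it is
   then a right inverse, which is the completeness relation. *)
have VU : col_mx (v1^t*) (v2^t*) *m row_mx v1 v2 = 1%:M.
  by rewrite mul_col_row v11 v12 v21 v22 -scalar_mx_block.
exact: (@mulmx1C _ 2 _ _ VU).
Qed.

Lemma mulmx_dyads n (v w : 'cV[C]_n) (Y : 'M[C]_n) :
  (v *m v^t*) *m Y *m (w *m w^t*) = (v^t* *m Y *m w) 0 0 *: (v *m w^t*).
Proof. by rewrite scalemxAl -mul_mx_scalar -mx11_scalar !mulmxA. Qed.

(** Multiply [Y] on both sides by the resolution of the identity into the two projections. *)
Lemma dyads_sum (v1 v2 : 'cV[C]_2) (Y : 'M[C]_2)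
    (e := fun v w => (v^t* *m Y *m w) 0 0) :
  orthonormal_basis2 v1 v2 ->
  Y = e v1 v1 *: (v1 *m v1^t*) + e v1 v2 *: (v1 *m v2^t*)
    + (e v2 v1 *: (v2 *m v1^t*) + e v2 v2 *: (v2 *m v2^t*)).
Proof.
move=> /orthonormal_basis2_complete v12; rewrite -!mulmx_dyads -!mulmxDr.
by rewrite v12 !mulmx1 -mulmxDl v12 mul1mx.
Qed.

Lemma free_orthonormal_projections (v1 v2 : 'cV[C]_2) :
  orthonormal_basis2 v1 v2 -> free [:: v1 *m v1^t*; v2 *m v2^t*].
Proof.
case=> v11 v22 v12.
have sq0 (v : 'cV[C]_2) : v^t* *m v = 1%:M -> v *m v^t* != 0.
  move=> vv; apply/eqP => v0; have /eqP := congr1 mxtrace vv.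
  by rewrite mxtrace_mulC v0 mxtrace0 mxtrace1 eq_sym oner_eq0.
rewrite free_cons span_seq1 seq1_free !sq0 // andbT.
apply/vlineP => -[k v1E].
(* If [P1 = k *: P2], then [P1 = P1 *m P1 = k *: (P1 *m P2) = 0] by orthogonality. *)
have : (v1 *m v1^t*) *m (v1 *m v1^t*) = 0.
  rewrite {2}v1E -scalemxAr -mulmxA (mulmxA (v1^t*)) v12.
  by rewrite mul0mx mulmx0 scaler0.
by rewrite -mulmxA (mulmxA (v1^t*)) v11 mul1mx => /eqP; apply/negP/sq0.
Qed.

(** In an eigenbasis of [H], both [1%:M] and [H] are combinations of the two projections; being
    free, they span a space of dimension 2, so the inclusion is an equality. *)
Lemma span_1_hermitian (H : 'M[C]_2) : H^t* = H -> H \notin <[1%:M]>%VS ->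
  span_of_orthonormal_projections <<[:: 1%:M; H]>>%VS.
Proof.
move=> hermH Hscal; pose P := spectralmx H.
have /unitarymxP PPt : P \is unitarymx by apply: spectral_unitarymx.
(* As [H] is [P^t* *m D *m P] with [D] diagonal, its eigenvectors are the columns of [P^t*]. *)
pose v (i : 'I_2) : 'cV[C]_2 := P^t* *m delta_mx i 0.
have form_v A i j : ((v i)^t* *m A *m v j) 0 0 = (P *m A *m P^t*) i j.
  by rewrite -[RHS]form_delta trmxC_mul trmxCK !mulmxA.
have basis_v : orthonormal_basis2 (v 0) (v 1).
  have dot i j : (v i)^t* *m v j = ((i == j)%:R)%:M.
    by rewrite [LHS]mx11_scalar -[_^t*]mulmx1 form_v mulmx1 PPt mxE.
  by split; rewrite dot //= raddf0.
have dot i j : ((v i)^t* *m H *m v j) 0 0 = diag_mx (spectral_diag H) i j.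
  have /orthomx_spectralP HE : H \is normalmx by apply/normalmxP; rewrite hermH.
  rewrite form_v [in LHS]HE -/P (invmx_unitary (spectral_unitarymx H)) -/P.
  by rewrite !mulmxA PPt mul1mx -mulmxA PPt mulmx1.
pose v0 := v 0; pose v1 := v 1; exists v0, v1; split=> //.
apply/eqP; rewrite eqEdim; apply/andP; split; last first.
  rewrite (leq_trans (dim_span _)) //.
  suff /eqnP-> : free [:: 1%:M; H] by [].
  rewrite (perm_free (_ : perm_eq _ [:: H; 1%:M])).
    2: by rewrite (perm_catC [:: 1%:M] [:: H]).
  rewrite free_cons span_seq1 seq1_free Hscal /=.
  by rewrite -mxrank_eq0 mxrank1.
have [P0 P1] : v0 *m v0^t* \in <<[:: v0 *m v0^t*; v1 *m v1^t*]>>%VS /\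
               v1 *m v1^t* \in <<[:: v0 *m v0^t*; v1 *m v1^t*]>>%VS.
  by split; rewrite memv_span ?inE ?eqxx ?orbT.
apply/span_subvP => X; rewrite !inE => /pred2P[]->.
  by rewrite -(orthonormal_basis2_complete basis_v) rpredD.
rewrite [H](dyads_sum _ basis_v) !dot.
by rewrite !mxE /= !mulr0n !scale0r addr0 add0r rpredD ?rpredZ.
Qed.

Lemma star_subalgebra_projections (A : {vspace 'M[C]_2}) (v1 v2 : 'cV[C]_2) :
  unital_star_subalgebra A -> orthonormal_basis2 v1 v2 ->
  (<<[:: v1 *m v1^t*; v2 *m v2^t*]>> <= A)%VS ->
  A = {: 'M[C]_2}%VS \/ A = <<[:: v1 *m v1^t*; v2 *m v2^t*]>>%VS.
Proof.
move=> [[_ _ mulA] starA] v12 /span_subvP sPA.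
have {}mulA X Y : X \in A -> Y \in A -> X *m Y \in A by apply: mulA.
have P1 : v1 *m v1^t* \in A by rewrite sPA ?mem_head.
have P2 : v2 *m v2^t* \in A by rewrite sPA ?inE ?eqxx ?orbT.
case: (boolP (v1 *m v2^t* \in A)) => [E12|nE12]; [left|right]; apply/vspaceP => Y.
  (* With the adjoint of [E12], all four matrix units of the basis lie in [A]. *)
  have E21 : v2 *m v1^t* \in A by rewrite -[v2]trmxCK -trmxC_mul starA.
  by rewrite memvf (dyads_sum Y v12) !rpredD ?rpredZ.
apply/idP/idP => [YA|]; last by apply/subvP/span_subvP.
(* Compressing [Z] between the two projections isolates its off-diagonal entry times [v1 *m v2^t*],
   which is not in [A]. *)
have off0 Z : Z \in A -> (v1^t* *m Z *m v2) 0 0 = 0.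
  move=> ZA; apply: contraNeq nE12 => z0.
  have : (v1^t* *m Z *m v2) 0 0 *: (v1 *m v2^t*) \in A.
    by rewrite -mulmx_dyads !mulA.
  by rewrite rpredZeq (negPf z0).
have off0' : (v2^t* *m Y *m v1) 0 0 = 0.
  have -> : v2^t* *m Y *m v1 = (v1^t* *m Y^t* *m v2)^t*.
    by rewrite !trmxC_mul !trmxCK mulmxA.
  by rewrite mxE mxE off0 ?rmorph0 ?starA.
rewrite (dyads_sum Y v12) off0 // off0' !scale0r addr0 add0r.
by rewrite rpredD ?rpredZ ?memv_span ?inE ?eqxx ?orbT.
Qed.

Lemma star_subalgebra_classification (A : {vspace 'M[C]_2}) :
  unital_star_subalgebra A ->
  [\/ A = {: 'M[C]_2}%VS, A = <[1%:M]>%VS | span_of_orthonormal_projections A].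
Proof.
move=> subA; have [[A1 _ _] starA] := subA.
case: (boolP (A <= <[1%:M]>)%VS) => [sA1|/subvPn[X XA nX]].
  by constructor 2; apply/eqP; rewrite eqEsubv sA1 -memvE.
have [H [HA hermH nH]] : exists H, [/\ H \in A, H^t* = H & H \notin <[1%:M]>%VS].
  (* Up to factors, these are the real and imaginary parts of [X]; if both were scalar, so would be
     [X]. *)
  case: (boolP (X + X^t* \in <[1%:M]>%VS)) => [re|nre]; last first.
    by exists (X + X^t*); rewrite rpredD ?starA // trmxCD trmxCK addrC.
  exists ('i *: (X - X^t*)); split.
  - by rewrite rpredZ // rpredB ?starA.
  - by rewrite trmxCZ trmxCD trmxCN trmxCK conjCi scaleNr -scalerN opprB.
  - apply: contra nX => im; rewrite -[X](scalerK (_ : 2 != 0 :> C)) ?pnatr_eq0 //.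
    have -> : 2 *: X = (X + X^t*) - 'i *: ('i *: (X - X^t*)).
      rewrite scalerA -expr2 sqrCi scaleN1r opprK addrACA subrr addr0.
      by rewrite scaler_nat mulr2n.
    by rewrite rpredZ // rpredB // rpredZ.
have [v1 [v2 [v12 spanE]]] := span_1_hermitian hermH nH.
have sPA : (<<[:: v1 *m v1^t*; v2 *m v2^t*]>> <= A)%VS.
  by rewrite -spanE; apply/span_subvP => Z; rewrite !inE => /pred2P[]->.
have [->|->] := star_subalgebra_projections subA v12 sPA; first by constructor 1.
by constructor 3; exists v1, v2.
Qed.

(** * The Pauli basis and Pauli-diagonal maps *)

Lemma dim_scalars : \dim (<[1%:M]> : {vspace 'M[C]_2}) = 1%N.
Proof. by rewrite dim_vline -mxrank_eq0 mxrank1. Qed.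

Definition pauli_basis : 4.-tuple 'M[C]_2 :=
  [tuple 1%:M; sigma_x C; sigma_y C; sigma_z C].

Lemma pauli_basis_basis : basis_of {: 'M[C]_2} pauli_basis.
Proof.
rewrite basisEfree subvf size_tuple dimvf /dim /= andbT.
apply/freeP => k; rewrite !big_ord_recl big_ord0 /= => /matrixP k0.
(* With coefficients [a, b, c, d], the entries are [a + d], [b - ic], [b + ic] and [a - d]. *)
have := (k0 0 0, k0 0 1, k0 1 0, k0 1 1).
rewrite !mxE /= !(mulr0, mulr1, mulrN1, addr0, add0r, mulrN).
move=> [[[k00 k01] k10] k11].
have [a0 d0] := add_sub_eq0 (V := C^o) k00 k11.
have [b0 c0] := add_sub_eq0 (V := C^o) k10 k01.
have {}c0 : k (lift ord0 (lift ord0 ord0)) = 0.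
  by move/eqP: c0; rewrite mulf_eq0 (negPf (neq0Ci C)) orbF => /eqP.
case=> [] [|[|[|[|//]]]] lt_i4.
- by rewrite -[RHS]a0; congr k; apply: val_inj.
- by rewrite -[RHS]b0; congr k; apply: val_inj.
- by rewrite -[RHS]c0; congr k; apply: val_inj.
- by rewrite -[RHS]d0; congr k; apply: val_inj.
Qed.

Lemma mx2_trmxC (a b c d : C) : (mx2 a b c d)^t* = mx2 a^* c^* b^* d^*.
Proof. by apply/matrixP => -[[|[|//]] i2] [[|[|//]] j2]; rewrite !mxE. Qed.

Lemma pauli_basis_hermitian : {in pauli_basis, forall X, X^t* = X}.
Proof.
move=> X; rewrite !inE => /or4P[] /eqP->; rewrite ?trmxC1 // mx2_trmxC.
- by rewrite rmorph0 rmorph1.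
- by rewrite rmorph0 rmorphN /= conjCi opprK.
- by rewrite rmorph0 rmorphN1 rmorph1.
Qed.

Section PauliDiagonal.
Variables (Psi : {linear 'M[C]_2 -> 'M[C]_2}) (l1 l2 l3 : C).
Hypotheses (Psi1 : Psi 1%:M = 1%:M) (Psix : Psi (sigma_x C) = l1 *: sigma_x C).
Hypotheses (Psiy : Psi (sigma_y C) = l2 *: sigma_y C).
Hypotheses (Psiz : Psi (sigma_z C) = l3 *: sigma_z C).

(** The identity is always fixed and heads the list; the mask keeps the Pauli matrices of eigenvalue
    1, so that the dimension becomes a count. *)
Lemma fixed_points_pauli : fixed_points Psi =
  <<1%:M :: mask [:: l1 == 1; l2 == 1; l3 == 1] (behead pauli_basis)>>%VS.
Proof.
have fixedE l X : Psi X = l *: X -> X \in pauli_basis -> (Psi X == X) = (l == 1).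
  move=> -> XP; rewrite -subr_eq0 -{2}[X]scale1r -scalerBl scaler_eq0 subr_eq0.
  by rewrite (negPf (free_not0 (basis_free pauli_basis_basis) XP)) orbF.
rewrite /fixed_points (fixedSpace_eigenbasis pauli_basis_basis); last first.
  move=> X; rewrite lfunE !inE => /or4P[] /eqP-> /=; last by exists l3.
  - by exists 1; rewrite Psi1 scale1r.
  - by exists l1.
  - by exists l2.
congr span; rewrite /= !lfunE Psi1 eqxx.
rewrite (fixedE _ _ Psix) ?(fixedE _ _ Psiy) ?(fixedE _ _ Psiz);
  try by rewrite !inE eqxx ?orbT.
by do 3 case: eqP.
Qed.

Lemma dim_fixed_points_pauli :
  \dim (fixed_points Psi) = (count_mem 1 [:: l1; l2; l3]).+1.
Proof.
rewrite fixed_points_pauli; set X := _ :: _.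
suff /eqnP-> : free X by rewrite /X /=; do 3 case: eqP.
(* A subfamily of the free Pauli basis is free. *)
have -> : X = mask (true :: [:: l1 == 1; l2 == 1; l3 == 1]) pauli_basis by [].
have free_pauli := basis_free pauli_basis_basis.
by rewrite mask_filter ?filter_free // free_uniq.
Qed.

Lemma fixed_points_pauli_full :
  fixed_points Psi = {: 'M[C]_2}%VS <->
  [/\ l1 = 1, l2 = 1, l3 = 1 & forall X, Psi X = X].
Proof.
split=> [fixT|[_ _ _ PsiX]]; last first.
  by apply/vspaceP => X; rewrite memvf; apply/fixed_pointsP.
have PsiX X : Psi X = X by apply/fixed_pointsP; rewrite fixT memvf.
(* Dimension 4 forces the count to be 3. *)
move: dim_fixed_points_pauli; rewrite fixT dimvf /dim /=.
by do 3 case: eqP => ? //=.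
Qed.

Lemma fixed_points_pauli_scalar :
  fixed_points Psi = <[1%:M]>%VS <-> [/\ l1 <> 1, l2 <> 1 & l3 <> 1].
Proof.
split=> [fix1|[/eqP n1 /eqP n2 /eqP n3]].
  move: dim_fixed_points_pauli; rewrite fix1 dim_scalars /=.
  by do 3 case: eqP => ? //=.
by rewrite fixed_points_pauli (negPf n1) (negPf n2) (negPf n3) span_seq1.
Qed.

Lemma fixed_points_pauli_projections :
  span_of_orthonormal_projections (fixed_points Psi) <->
  count_mem 1 [:: l1; l2; l3] = 1%N.
Proof.
split=> [[v1 [v2 [v12 fixE]]]|count1].
  (* Two free projections give dimension 2, one more than the count. *)
  apply: succn_inj; rewrite -dim_fixed_points_pauli fixE.
  exact/eqnP/free_orthonormal_projections.
have [X XP fixE] : exists2 X, X \in pauli_basis &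
    fixed_points Psi = <<[:: 1%:M; X]>>%VS.
  rewrite fixed_points_pauli; move: count1 => /=.
  do 3 case: eqP => ? //=; move=> _.
  - by exists (sigma_x C); rewrite ?inE ?eqxx ?orbT.
  - by exists (sigma_y C); rewrite ?inE ?eqxx ?orbT.
  - by exists (sigma_z C); rewrite ?inE ?eqxx ?orbT.
rewrite fixE; apply: span_1_hermitian; first exact: pauli_basis_hermitian.
(* A scalar [X] would bring the dimension down to 1, whereas the count makes it 2. *)
apply/negP => X1.
have : (\dim (fixed_points Psi) <= \dim (<[1%:M]> : {vspace 'M[C]_2}))%N.
  by rewrite dimvS // fixE span_cons span_seq1 subv_add subvv -memvE.
by rewrite dim_fixed_points_pauli count1 dim_scalars.
Qed.

End PauliDiagonal.

End UnitalQubitChannels.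

(* In the claims about l1, l2, l3 the map is the Pauli-diagonal form Psi itself:
   they fail for Phi when the input and output unitaries are unrelated, e.g. the
   conjugation by sigma_x has the identity map as a Pauli-diagonal form. *)
Theorem corollary2p6 (R : realType) (Phi : {linear 'M[R[i]]_2 -> 'M[R[i]]_2})
    (channelPhi : quantum_channel Phi) (unitalPhi : unital Phi) :
  [/\ unital_star_subalgebra (fixed_points Phi),
      [\/ fixed_points Phi = {: 'M[R[i]]_2}%VS,
          fixed_points Phi = <[1%:M]>%VS
        | span_of_orthonormal_projections (fixed_points Phi)]
    & forall (Psi : {linear 'M[R[i]]_2 -> 'M[R[i]]_2}) (l1 l2 l3 : R),
      pauli_diagonal_form Phi Psi l1 l2 l3 ->
      [/\ fixed_points Psi = {: 'M[R[i]]_2}%VS <->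
            [/\ l1 = 1, l2 = 1, l3 = 1 & forall X, Psi X = X],
          fixed_points Psi = <[1%:M]>%VS <->
            [/\ l1 <> 1, l2 <> 1 & l3 <> 1]
        & span_of_orthonormal_projections (fixed_points Psi) <->
            count_mem 1 [:: l1; l2; l3] = 1%N]].
Proof.
have subPhi := fixed_points_star_subalgebra channelPhi unitalPhi.
split=> //; first exact: star_subalgebra_classification.
move=> Psi l1 l2 l3 [_ [Psi1 Psix Psiy Psiz]].
(* The eigenvalues in [R[i]] are embedded reals; equality with 1 passes through the injective
   embedding. *)
have real1 (l : R) : l%:C%C = 1 <-> l = 1 by split=> [/complexI|->].
split.
- rewrite (fixed_points_pauli_full Psi1 Psix Psiy Psiz).
  by split=> -[? ? ? ?]; split=> //; apply/real1.
- rewrite (fixed_points_pauli_scalar Psi1 Psix Psiy Psiz).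
  by split=> -[? ? ?]; split=> /real1.
- rewrite (fixed_points_pauli_projections Psi1 Psix Psiy Psiz).
  by rewrite /= !(inj_eq (@complexI R)).
Qed.
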